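(* Let $K$ be a field, $A$ a $K$-algebra, $B$ a finite dimensional $K$-algebra with basis $\mathcal{B}=\{b_1,\dots,b_n\}$ and structure constants $\lambda_{ij}^k$ (so $b_ib_j=\sum_k\lambda_{ij}^kb_k$). Let $\chi\colon A\otimes B\to B\otimes A$ be a twisting map and let $\gamma_i^j\colon A\to A$ ($1\le i,j\le n$) be the $K$-linear maps determined by $\chi(a\otimes b_i)=\sum_{j=1}^n b_j\otimes\gamma_i^j(a)$ for all $a\in A$. Then the formulas $$\varphi_\chi(a):=\begin{pmatrix}\gamma_1^1(a)&\dots&\gamma_n^1(a)\\ \vdots&\ddots&\vdots\\ \gamma_1^n(a)&\dots&\gamma_n^n(a)\end{pmatrix}\quad\text{and}\quad \varphi_\chi(b_k):=\begin{pmatrix}\lambda_{k1}^1\cdot1_A&\dots&\lambda_{kn}^1\cdot1_A\\ \vdots&\ddots&\vdots\\ \lambda_{k1}^n\cdot1_A&\dots&\lambda_{kn}^n\cdot1_A\end{pmatrix},$$ for all $a\in A$ and $1\le k\le n$, define a faithful representation $\varphi_\chi\colon B\otimes_\chi A\to M_n(A)$.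
   Context: Algebras are associative and unital, algebra morphisms are unital, all maps are $K$-linear, and $\otimes=\otimes_K$; $\mu_A,\mu_B$ are the multiplication maps. A twisting map is a $K$-linear map $\chi\colon A\otimes B\to B\otimes A$ such that $\chi(1\otimes b)=b\otimes1$, $\chi(a\otimes1)=1\otimes a$ for all $a\in A$, $b\in B$; $\chi\circ(\mu_A\otimes B)=(B\otimes\mu_A)\circ(\chi\otimes A)\circ(A\otimes\chi)$; and $\chi\circ(A\otimes\mu_B)=(\mu_B\otimes A)\circ(B\otimes\chi)\circ(\chi\otimes B)$ (here an algebra used as a map denotes its identity map). Then $B\otimes_\chi A$ denotes the algebra with underlying space $B\otimes A$ and multiplication $(\mu_B\otimes\mu_A)\circ(B\otimes\chi\otimes A)$. In $B\otimes_\chi A$ one identifies $a\in A$ with $1\otimes a$ and $b\in B$ with $b\otimes1$, so that $b\otimes a=(b\otimes1)(1\otimes a)$; thus $\varphi_\chi(a)$ and $\varphi_\chi(b_k)$ mean $\varphi_\chi(1\otimes a)$ and $\varphi_\chi(b_k\otimes1)$, and $\varphi_\chi(b_k\otimes a)=\varphi_\chi(b_k)\varphi_\chi(a)$. A faithful representation is an injective (unital) algebra morphism. *)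

(* Defs.v *)
From HB Require Import structures.
From mathcomp Require Import all_boot all_algebra all_field.
From mathcomp Require Import sesquilinear ring_quotient boolp freeg.

Set Implicit Arguments.
Unset Strict Implicit.
Unset Printing Implicit Defensive.

Import GRing.Theory.
Import Quotient.
Local Open Scope ring_scope.
Local Open Scope quotient_scope.

Section Freeg.
Variables (K : fieldType) (T : choiceType).

Lemma freegUZ c (x : T) : << c *g x >> = c *: << x >> :> {freeg T / K}.
Proof. by apply/eqP/freeg_eqP=> y; rewrite coeffZ !coeffU mul1r. Qed.

Lemma freegUM c k (x : T) : c *: << k *g x >> = << c * k *g x >> :> {freeg T / K}.
Proof. by rewrite freegUZ scalerA -freegUZ. Qed.

Variables (U : lmodType K) (f : T -> U).

Fact fglift_linear : linear (fglift f : {freeg T / K} -> U).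
Proof.
have hB : zmod_morphism (fglift f : {freeg T / K} -> U).
  exact: lift_is_additive.
pose h : {additive {freeg T / K} -> U} :=
  HB.pack (fglift f) (GRing.isZmodMorphism.Build _ _ _ hB).
have hU a z : h << a *g z >> = a *: f z by exact: liftU.
move=> c x y; rewrite -[fglift f]/(h : _ -> _) raddfD; congr (_ + _).
rewrite -(freeg_sumE x) scaler_sumr !raddf_sum.
by apply: eq_bigr => z _; rewrite freegUM !hU /=; rewrite scalerA.
Qed.

HB.instance Definition _ :=
  GRing.isLinear.Build K {freeg T / K} U *:%R (fglift f) fglift_linear.

End Freeg.

(* V (x) W is the free K-module on V * W modulo the span of the bilinearity   *)
(* relators; no finiteness assumption is made on V and W.                     *)
Section TensorProduct.
Variables (K : fieldType) (V W : lmodType K).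

Inductive tensor_null : {freeg (V * W) / K} -> Prop :=
| tensor_null_Dl v v' w :
    tensor_null (<< (v + v', w) >> - (<< (v, w) >> + << (v', w) >>))
| tensor_null_Dr v w w' :
    tensor_null (<< (v, w + w') >> - (<< (v, w) >> + << (v, w') >>))
| tensor_null_Zl c v w : tensor_null (<< (c *: v, w) >> - c *: << (v, w) >>)
| tensor_null_Zr c v w : tensor_null (<< (v, c *: w) >> - c *: << (v, w) >>)
| tensor_null0 : tensor_null 0
| tensor_nullD x y : tensor_null x -> tensor_null y -> tensor_null (x + y)
| tensor_nullZ c x : tensor_null x -> tensor_null (c *: x).

Definition tensor_nullb : {pred {freeg (V * W) / K}} :=
  fun x => `[< tensor_null x >].

Lemma tensor_nullP x : reflect (tensor_null x) (x \in tensor_nullb).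
Proof. exact: asboolP. Qed.

Lemma tensor_nullb_closed : zmod_closed tensor_nullb.
Proof.
split=> [|x y /tensor_nullP nx /tensor_nullP ny]; apply/tensor_nullP.
  exact: tensor_null0.
by apply: tensor_nullD => //; rewrite -scaleN1r; apply: tensor_nullZ.
Qed.

HB.instance Definition _ :=
  GRing.isZmodClosed.Build {freeg (V * W) / K} tensor_nullb tensor_nullb_closed.

Definition tensor_submod : zmodClosed {freeg (V * W) / K} := tensor_nullb.

Definition tensor := {quot tensor_submod}.
HB.instance Definition _ := GRing.Zmodule.on tensor.

Definition tensor_pi (x : {freeg (V * W) / K}) : tensor := \pi_tensor x.

Lemma tensor_piP x y : reflect (tensor_null (x - y)) (tensor_pi x == tensor_pi y).
Proof.
by rewrite /tensor_pi -idealrBE; exact: tensor_nullP.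
Qed.

Lemma tensor_piK (x : tensor) : tensor_pi (repr x) = x.
Proof. exact: reprK. Qed.

Lemma tensor_piD x y : tensor_pi (x + y) = tensor_pi x + tensor_pi y.
Proof. by rewrite /tensor_pi; exact: (pi_add tensor_submod). Qed.

Definition tensor_scale c (x : tensor) : tensor := tensor_pi (c *: repr x).

Lemma tensor_scale_pi c x : tensor_scale c (tensor_pi x) = tensor_pi (c *: x).
Proof.
apply/eqP/tensor_piP; rewrite -scalerBr; apply: tensor_nullZ.
by apply/tensor_piP; rewrite tensor_piK.
Qed.

Fact tensor_scaleA a c x :
  tensor_scale a (tensor_scale c x) = tensor_scale (a * c) x.
Proof. by rewrite -[x]tensor_piK !tensor_scale_pi scalerA. Qed.
Fact tensor_scale1 : left_id 1 tensor_scale.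
Proof. by move=> x; rewrite -[x]tensor_piK tensor_scale_pi scale1r. Qed.
Fact tensor_scaleDr : right_distributive tensor_scale +%R.
Proof.
move=> c x y; rewrite -[x]tensor_piK -[y]tensor_piK.
by rewrite -tensor_piD !tensor_scale_pi scalerDr tensor_piD.
Qed.
Fact tensor_scaleDl x : {morph tensor_scale^~ x : a c / a + c}.
Proof.
by move=> a c; rewrite -[x]tensor_piK !tensor_scale_pi scalerDl tensor_piD.
Qed.

HB.instance Definition _ := GRing.Zmodule_isLmodule.Build K tensor
  tensor_scaleA tensor_scale1 tensor_scaleDr tensor_scaleDl.

Lemma tensor_piZ c x : tensor_pi (c *: x) = c *: tensor_pi x.
Proof. by rewrite -tensor_scale_pi. Qed.

Fact tensor_piB : zmod_morphism tensor_pi.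
Proof. by move=> x y; rewrite tensor_piD -scaleN1r tensor_piZ scaleN1r. Qed.

HB.instance Definition _ :=
  GRing.isZmodMorphism.Build _ _ tensor_pi tensor_piB.
HB.instance Definition _ :=
  GRing.isScalable.Build _ _ _ _ tensor_pi tensor_piZ.

Definition tens (v : V) (w : W) : tensor := tensor_pi << (v, w) >>.


Lemma tens_bilinear : bilinear_for *:%R *:%R tens.
Proof.
split=> [w c v v'|v c w w'] /=; rewrite /tens.
  apply/(@etrans _ _ (tensor_pi (<<(c *: v, w)>> + <<(v', w)>>))).
    by apply/eqP/tensor_piP/tensor_null_Dl.
  rewrite tensor_piD -tensor_piZ; congr (_ + _).
  by apply/eqP/tensor_piP/tensor_null_Zl.
apply/(@etrans _ _ (tensor_pi (<<(v, c *: w)>> + <<(v, w')>>))).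
  by apply/eqP/tensor_piP/tensor_null_Dr.
rewrite tensor_piD -tensor_piZ; congr (_ + _).
by apply/eqP/tensor_piP/tensor_null_Zr.
Qed.

HB.instance Definition _ :=
  bilinear_isBilinear.Build K V W tensor *:%R *:%R tens tens_bilinear.
HB.instance Definition _ v :=
  GRing.isLinear.Build K W tensor *:%R (tens v) (tens_bilinear.2 v).

Lemma tensor_ind (P : tensor -> Prop) :
  (forall v w, P (tens v w)) -> (forall x y, P x -> P y -> P (x + y)) ->
  forall x, P x.
Proof.
move=> Pt PD x; rewrite -[x]tensor_piK -[repr x]freeg_sumE.
elim: (dom _) => [|[v w] s IHs].
  by rewrite big_nil raddf0 -(linear0l tens 0); apply: Pt.
rewrite big_cons raddfD; apply: PD => {IHs} //.
by rewrite freegUZ /= tensor_piZ -[tensor_pi _]/(tens v w) -linearZl_LR; apply: Pt.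
Qed.

End TensorProduct.

Notation "v \ox w" := (tens v w) (at level 40, left associativity) : ring_scope.

Section TensorLift.
Variables (K : fieldType) (V W U : lmodType K).

Definition tensor_lift (f : {bilinear V -> W -> U}) (x : tensor V W) : U :=
  fglift (fun p => f p.1 p.2) (repr x).

Variable f : {bilinear V -> W -> U}.

Lemma tensor_lift_pi x :
  tensor_lift f (tensor_pi x) = fglift (fun p => f p.1 p.2) x.
Proof.
pose h := fglift (fun p : V * W => f p.1 p.2).
have hU p : h << p >> = f p.1 p.2 by rewrite /h liftU scale1r.
have hB y z : h (y - z) = h y - h z by exact: raddfB.
have hD y z : h (y + z) = h y + h z by exact: raddfD.
have hZ c y : h (c *: y) = c *: h y by exact: linearZ.
suff h0 y : tensor_null y -> h y = 0.
  apply/subr0_eq; rewrite -hB; apply: h0; apply/tensor_piP.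
  by rewrite tensor_piK.
elim=> {y} [v v' w|v w w'|c v w|c v w||y z _ yh _ zh|c y _ yh].
- by rewrite hB hD !hU /= linearDl subrr.
- by rewrite hB hD !hU /= linearDr subrr.
- by rewrite hB hZ !hU /= linearZl_LR subrr.
- by rewrite hB hZ !hU /= linearZr_LR subrr.
- exact: raddf0.
- by rewrite hD yh zh addr0.
- by rewrite hZ yh scaler0.
Qed.

Fact tensor_lift_linear : linear (tensor_lift f).
Proof.
move=> c x y; rewrite -[x]tensor_piK -[y]tensor_piK -linearP.
by rewrite !tensor_lift_pi linearP.
Qed.

HB.instance Definition _ :=
  GRing.isLinear.Build K (tensor V W) U *:%R (tensor_lift f) tensor_lift_linear.

Lemma tensor_liftE v w : tensor_lift f (v \ox w) = f v w.
Proof. by rewrite tensor_lift_pi liftU scale1r. Qed.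
End TensorLift.

Section TensorMap.
Variables (K : fieldType) (V V' W W' : lmodType K).
Variables (f : {linear V -> V'}) (g : {linear W -> W'}).

Definition tensor_map_tens (v : V) (w : W) : tensor V' W' := f v \ox g w.

Fact tensor_map_tens_bilinear : bilinear_for *:%R *:%R tensor_map_tens.
Proof.
split=> [w c v v'|v c w w']; rewrite /tensor_map_tens /= linearP.
  by rewrite linearPl.
by rewrite linearPr.
Qed.

HB.instance Definition _ := bilinear_isBilinear.Build K V W (tensor V' W')
  *:%R *:%R tensor_map_tens tensor_map_tens_bilinear.

Definition tensor_map : tensor V W -> tensor V' W' :=
  tensor_lift tensor_map_tens.

HB.instance Definition _ := GRing.Linear.on tensor_map.

Lemma tensor_mapE v w : tensor_map (v \ox w) = f v \ox g w.
Proof. exact: tensor_liftE. Qed.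

End TensorMap.

Notation "f \tmap g" := (tensor_map f g)
  (at level 40, left associativity) : ring_scope.

Section TensorAssoc.
Variables (K : fieldType) (U V W : lmodType K).

Definition tensor_assoc_tens (x : tensor U V) (w : W) : tensor U (tensor V W) :=
  (idfun \tmap applyr (@tens K V W) w) x.

Fact tensor_assoc_tens_bilinear : bilinear_for *:%R *:%R tensor_assoc_tens.
Proof.
rewrite /tensor_assoc_tens; split=> [w c x y|x c w w'] /=; first exact: linearP.
elim/tensor_ind: x => [u v|x y IHx IHy].
  by rewrite !tensor_mapE /= !linearPr.
by rewrite !raddfD /= IHx IHy addrACA.
Qed.

HB.instance Definition _ := bilinear_isBilinear.Build K (tensor U V) W
  (tensor U (tensor V W)) *:%R *:%R tensor_assoc_tens tensor_assoc_tens_bilinear.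

Definition tensor_assoc : tensor (tensor U V) W -> tensor U (tensor V W) :=
  tensor_lift tensor_assoc_tens.

HB.instance Definition _ := GRing.Linear.on tensor_assoc.

Lemma tensor_assocE u v w : tensor_assoc (u \ox v \ox w) = u \ox (v \ox w).
Proof. by rewrite /tensor_assoc tensor_liftE /= /tensor_assoc_tens tensor_mapE. Qed.

Definition tensor_assocV_tens (u : U) (y : tensor V W) : tensor (tensor U V) W :=
  (@tens K U V u \tmap idfun) y.

Fact tensor_assocV_tens_bilinear : bilinear_for *:%R *:%R tensor_assocV_tens.
Proof.
rewrite /tensor_assocV_tens; split=> [y c u u'|u c x y] /=; last exact: linearP.
elim/tensor_ind: y => [v w|x y IHx IHy].
  by rewrite !tensor_mapE /= !linearPl.
by rewrite !raddfD /= IHx IHy addrACA.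
Qed.

HB.instance Definition _ := bilinear_isBilinear.Build K U (tensor V W)
  (tensor (tensor U V) W) *:%R *:%R tensor_assocV_tens
  tensor_assocV_tens_bilinear.

Definition tensor_assocV : tensor U (tensor V W) -> tensor (tensor U V) W :=
  tensor_lift tensor_assocV_tens.

HB.instance Definition _ := GRing.Linear.on tensor_assocV.

Lemma tensor_assocVE u v w : tensor_assocV (u \ox (v \ox w)) = u \ox v \ox w.
Proof. by rewrite /tensor_assocV tensor_liftE /= /tensor_assocV_tens tensor_mapE. Qed.

End TensorAssoc.

Section Multiplication.
Variables (K : fieldType) (A : algType K).

Definition alg_mul (a a' : A) : A := a * a'.

Fact alg_mul_bilinear : bilinear_for *:%R *:%R alg_mul.
Proof.
rewrite /alg_mul; split=> [a' c x y|a c x y] /=.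
  by rewrite mulrDl scalerAl.
by rewrite mulrDr scalerAr.
Qed.

HB.instance Definition _ :=
  bilinear_isBilinear.Build K A A A *:%R *:%R alg_mul alg_mul_bilinear.
HB.instance Definition _ a :=
  GRing.isLinear.Build K A A *:%R (alg_mul a) (alg_mul_bilinear.2 a).

Definition mu : tensor A A -> A := tensor_lift alg_mul.

HB.instance Definition _ := GRing.Linear.on mu.

Lemma muE a a' : mu (a \ox a') = a * a'.
Proof. exact: tensor_liftE. Qed.

End Multiplication.

Arguments mu {K} A.

Section Twisting.
Variables (K : fieldType) (A B : algType K).

Record is_twisting (chi : {linear tensor A B -> tensor B A}) : Prop := IsTwisting {
  twisting1l : forall b : B, chi (1 \ox b) = b \ox 1;
  twisting1r : forall a : A, chi (a \ox 1) = 1 \ox a;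
  twistingMl : chi \o (mu A \tmap idfun) =1
    (idfun \tmap mu A) \o @tensor_assoc K B A A \o (chi \tmap idfun)
      \o @tensor_assocV K A B A \o (idfun \tmap chi) \o @tensor_assoc K A A B;
  twistingMr : chi \o (idfun \tmap mu B) =1
    (mu B \tmap idfun) \o @tensor_assocV K B B A \o (idfun \tmap chi)
      \o @tensor_assoc K B A B \o (chi \tmap idfun) \o @tensor_assocV K A B B
}.

Record twistingMap := TwistingMap {
  twisting_map :> {linear tensor A B -> tensor B A};
  twisting_mapP : is_twisting twisting_map
}.

(* The carrier does not mention chi: the parameter only selects the ring       *)
(* structure declared below.                                                  *)
Definition twisted_tensor (chi : twistingMap) : Type := tensor B A.
HB.instance Definition _ chi := GRing.Lmodule.on (twisted_tensor chi).

Variable chi : twistingMap.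
Local Notation T := (twisted_tensor chi).

(* (mu_B (x) mu_A) o (B (x) chi (x) A), with the rebracketings spelled out.   *)
Definition twisted_mul (x y : T) : T :=
  ((mu B \tmap mu A) \o @tensor_assocV K B B (tensor A A)
    \o (idfun \tmap @tensor_assoc K B A A)
    \o (idfun \tmap (chi \tmap idfun))
    \o (idfun \tmap @tensor_assocV K A B A)
    \o @tensor_assoc K B A (tensor B A)) (x \ox y).

Definition twisted_one : T := (1 : B) \ox (1 : A).

Local Notation tw b a := (alg_mul b \tmap applyr (@alg_mul K A) a).

Lemma tw_tw (b b' : B) (a a' : A) x :
  (tw b a) ((tw b' a') x) = (tw (b * b') (a' * a)) x.
Proof.
elim/tensor_ind: x => [d c|x y IHx IHy].
  by rewrite !tensor_mapE /= /alg_mul !mulrA.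
by rewrite !raddfD /= IHx IHy.
Qed.

Lemma tw1 (x : tensor B A) : (tw 1 1) x = x.
Proof.
elim/tensor_ind: x => [d c|x y IHx IHy].
  by rewrite !tensor_mapE /= /alg_mul mul1r mulr1.
by rewrite !raddfD /= IHx IHy.
Qed.

Fact twisted_mulDl : left_distributive twisted_mul +%R.
Proof. by move=> x y z; rewrite /twisted_mul linearDl raddfD. Qed.

Fact twisted_mulDr : right_distributive twisted_mul +%R.
Proof. by move=> x y z; rewrite /twisted_mul linearDr raddfD. Qed.

Fact twisted_mulZl c x y : twisted_mul (c *: x) y = c *: twisted_mul x y.
Proof. by rewrite /twisted_mul linearZl_LR linearZ. Qed.

Fact twisted_mulZr c x y : twisted_mul x (c *: y) = c *: twisted_mul x y.
Proof. by rewrite /twisted_mul linearZr_LR linearZ. Qed.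

Lemma twisted_mulE (b b' : B) (a a' : A) :
  twisted_mul (b \ox a) (b' \ox a') = (tw b a') (chi (a \ox b')).
Proof.
rewrite /twisted_mul /= tensor_assocE tensor_mapE /= tensor_assocVE.
rewrite tensor_mapE /= tensor_mapE tensor_mapE /=.
elim/tensor_ind: (chi _) => [d c|x y IHx IHy].
  by rewrite tensor_assocE tensor_assocVE !tensor_mapE /= !muE.
by rewrite linearDl !raddfD /= IHx IHy.
Qed.

Lemma twisting_mull a a' b :
  chi (a * a' \ox b) = twisted_mul (1 \ox a) (chi (a' \ox b)).
Proof.
have /= := twistingMl (twisting_mapP chi) (a \ox a' \ox b).
rewrite tensor_mapE /= muE => ->; rewrite tensor_assocE tensor_mapE /=.
elim/tensor_ind: (chi _) => [d c|x y IHx IHy].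
  rewrite twisted_mulE tensor_assocVE tensor_mapE /=.
  elim/tensor_ind: (chi _) => [d' c'|x y IHx IHy].
    by rewrite tensor_assocE !tensor_mapE /= muE /alg_mul mul1r.
  by rewrite linearDl !raddfD /= IHx IHy.
by rewrite linearDr !raddfD /= IHx IHy twisted_mulDr.
Qed.

Lemma twisting_mulr a b b' :
  chi (a \ox (b * b')) = twisted_mul (chi (a \ox b)) (b' \ox 1).
Proof.
have /= := twistingMr (twisting_mapP chi) (a \ox (b \ox b')).
rewrite tensor_mapE /= muE => ->; rewrite tensor_assocVE tensor_mapE /=.
elim/tensor_ind: (chi _) => [d c|x y IHx IHy].
  rewrite twisted_mulE tensor_assocE tensor_mapE /=.
  elim/tensor_ind: (chi _) => [d' c'|x y IHx IHy].
    by rewrite tensor_assocVE !tensor_mapE /= muE /alg_mul mulr1.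
  by rewrite linearDr !raddfD /= IHx IHy.
by rewrite linearDl !raddfD /= IHx IHy twisted_mulDl.
Qed.

Lemma twisted_mul_tw b a x y :
  twisted_mul ((tw b 1) x) ((tw 1 a) y) = (tw b a) (twisted_mul x y).
Proof.
elim/tensor_ind: x => [e f|x x' IHx IHx']; last first.
  by rewrite raddfD !twisted_mulDl raddfD /= IHx IHx'.
elim/tensor_ind: y => [d c|y y' IHy IHy']; last first.
  by rewrite raddfD !twisted_mulDr raddfD /= IHy IHy'.
by rewrite !tensor_mapE !twisted_mulE tw_tw /= /alg_mul mulr1 mul1r.
Qed.

Fact twisted_mulA : associative twisted_mul.
Proof.
have tensL (e : B) (f : A) : e \ox f = (tw e 1) (1 \ox f).
  by rewrite tensor_mapE /= /alg_mul !mulr1.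
have tensR (e : B) (f : A) : e \ox f = (tw 1 f) (e \ox 1).
  by rewrite tensor_mapE /= /alg_mul !mul1r.
move=> x y z.
elim/tensor_ind: x => [b a|x x' IHx IHx']; last by rewrite !twisted_mulDl IHx IHx'.
elim/tensor_ind: y => [b' a'|y y' IHy IHy']; last first.
  by rewrite !(twisted_mulDl, twisted_mulDr) IHy IHy'.
elim/tensor_ind: z => [b'' a''|z z' IHz IHz']; last by rewrite !twisted_mulDr IHz IHz'.
rewrite !twisted_mulE; apply: (@etrans _ _
  ((tw b a'') (twisted_mul (chi (a \ox b')) (chi (a' \ox b''))))).
  elim/tensor_ind: (chi (a' \ox b'')) => [d c|y y' IHy IHy']; last first.
    by rewrite !(raddfD, twisted_mulDr) /= IHy IHy'.
  rewrite tensor_mapE twisted_mulE /= /alg_mul twisting_mulr.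
  by rewrite -{2}[chi _]tw1 [d \ox c]tensR twisted_mul_tw tw_tw mulr1.
elim/tensor_ind: (chi (a \ox b')) => [e f|y y' IHy IHy']; last first.
  by rewrite !(raddfD, twisted_mulDl) /= IHy IHy'.
rewrite tensor_mapE twisted_mulE /= /alg_mul twisting_mull.
by rewrite -{1}[chi _]tw1 [e \ox f]tensL twisted_mul_tw tw_tw mul1r.
Qed.

Fact twisted_mul1l : left_id twisted_one twisted_mul.
Proof.
move=> x; elim/tensor_ind: x => [b a|x y IHx IHy].
  rewrite twisted_mulE twisting1l ?tensor_mapE /= /alg_mul ?mul1r //.
  exact: twisting_mapP.
by rewrite twisted_mulDr IHx IHy.
Qed.

Fact twisted_mul1r : right_id twisted_one twisted_mul.
Proof.
move=> x; elim/tensor_ind: x => [b a|x y IHx IHy].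
  rewrite twisted_mulE twisting1r ?tensor_mapE /= /alg_mul ?mulr1 //.
  exact: twisting_mapP.
by rewrite twisted_mulDl IHx IHy.
Qed.

End Twisting.

Section TwistedAlgebra.
Variables (K : fieldType) (A : algType K) (B : falgType K) (chi : twistingMap A B).
Local Notation T := (twisted_tensor chi).

(* MathComp algebras are nontrivial, so the ring instance needs 1 (x) 1 != 0;  *)
(* it is detected by the coordinate forms of the finite dimensional factor B.  *)
Definition coord_tens (i : 'I_(\dim (fullv : {vspace B}))) (b : B) (a : A) : A :=
  coord (vbasis fullv) i b *: a.

Fact coord_tens_bilinear i : bilinear_for *:%R *:%R (coord_tens i).
Proof.
rewrite /coord_tens; split=> [a c b b'|b c a a'] /=.
  by rewrite linearP scalerDl scalerA.
by rewrite scalerDr !scalerA mulrC.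
Qed.

HB.instance Definition _ i := bilinear_isBilinear.Build K B A A *:%R *:%R
  (coord_tens i) (coord_tens_bilinear i).

Fact twisted_one_neq0 : twisted_one chi != 0.
Proof.
apply/eqP=> e0; have c0 i : coord (vbasis fullv) i (1 : B) = 0.
  have := tensor_liftE (coord_tens i) 1 1.
  rewrite -[_ \ox _]/(twisted_one chi) e0 raddf0 => /esym/eqP.
  by rewrite scaler_eq0 oner_eq0 orbF => /eqP.
have /eqP := oner_neq0 B; apply.
by rewrite (coord_vbasis (memvf (1 : B))) big1 // => i _; rewrite c0 scale0r.
Qed.

HB.instance Definition _ := GRing.Zmodule_isNzRing.Build T
  (@twisted_mulA K A B chi) (@twisted_mul1l K A B chi)
  (@twisted_mul1r K A B chi) (@twisted_mulDl K A B chi)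
  (@twisted_mulDr K A B chi) twisted_one_neq0.

Fact twisted_scalerAl c (x y : T) : c *: (x * y) = (c *: x) * y.
Proof. by rewrite [RHS]twisted_mulZl. Qed.

HB.instance Definition _ :=
  GRing.Lmodule_isLalgebra.Build K T twisted_scalerAl.

Fact twisted_scalerAr c (x y : T) : c *: (x * y) = x * (c *: y).
Proof. by rewrite [RHS]twisted_mulZr. Qed.

HB.instance Definition _ :=
  GRing.Lalgebra_isAlgebra.Build K T twisted_scalerAr.

End TwistedAlgebra.

(* Main.v *)
Require Import Defs.
From HB Require Import structures.
From mathcomp Require Import all_boot all_algebra all_field.

Import GRing.Theory.
Local Open Scope ring_scope.

(** The algebra B (x)_chi A is a free right A-module on the elements
    b_1 (x) 1, ..., b_n (x) 1: because chi (a (x) 1) = 1 (x) a, right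
    multiplication by 1 (x) a only multiplies the A-factor on the right.
    Left multiplication commutes with this right action, so it is the left
    regular representation of B (x)_chi A on A^n, and phi_chi is its matrix form:
    column j of phi_chi x lists the coordinates in A of x * (b_j (x) 1).

    Everything follows from this description.  Multiplicativity is associativity
    of the twisted product, plus the fact that coordinates determine an
    element ([tens_sum_tcoord]).  The two displayed matrices are read off from
    (1 (x) a) * (b_j (x) 1) = chi (a (x) b_j) and
    (b_k (x) 1) * (b_j (x) 1) = b_k b_j (x) 1.  The representation is faithful
    because a left regular representation of a unital algebra is:
    if x kills every b_j (x) 1, then it kills the unit 1 (x) 1, which is a
    combination of them.  Uniqueness holds because the elements b_k (x) 1
    and 1 (x) a generate B (x)_chi A. *)

(** * Coordinates on B (x) A over a basis of B *)

Section Coordinates.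
Set Implicit Arguments.
Unset Strict Implicit.
Variables (K : fieldType) (A : algType K) (B : falgType K).
Variables (n : nat) (b : n.-tuple B).

Definition coord_scale (i : 'I_n) (d : B) (a : A) : A := coord b i d *: a.

Fact coord_scale_bilinear i : bilinear_for *:%R *:%R (coord_scale i).
Proof.
rewrite /coord_scale; split=> [a c d d'|d c a a'] /=.
  by rewrite linearP scalerDl scalerA.
by rewrite scalerDr !scalerA mulrC.
Qed.

HB.instance Definition _ i := bilinear_isBilinear.Build K B A A *:%R *:%R
  (coord_scale i) (coord_scale_bilinear i).

Definition tcoord (i : 'I_n) : tensor B A -> A := tensor_lift (coord_scale i).

HB.instance Definition _ i := GRing.Linear.on (tcoord i).

Lemma tcoordE i d a : tcoord i (d \ox a) = coord b i d *: a.
Proof. exact: tensor_liftE. Qed.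

Hypothesis hb : basis_of fullv b.

Lemma tcoord_basis (i j : 'I_n) (a : A) : tcoord i (b`_j \ox a) = (j == i)%:R *: a.
Proof. by rewrite tcoordE coord_free ?(basis_free hb). Qed.

Lemma tcoord_sum i (f : 'I_n -> A) :
  tcoord i (\sum_(j < n) b`_j \ox f j) = f i.
Proof.
rewrite raddf_sum (bigD1 i) //= tcoord_basis eqxx scale1r big1 ?addr0 // => j ji.
by rewrite tcoord_basis (negPf ji) scale0r.
Qed.

Lemma tens_sum_tcoord (x : tensor B A) :
  x = \sum_(i < n) b`_i \ox tcoord i x.
Proof.
elim/tensor_ind: x => [d a|x y IHx IHy]; last first.
  rewrite {1}IHx {1}IHy -big_split /=; apply: eq_bigr => i _.
  by rewrite raddfD linearDr.
rewrite {1}(coord_basis hb (memvf d)) linear_sumlz; apply: eq_bigr => i _.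
by rewrite tcoordE linearZl_LR linearZr_LR.
Qed.

End Coordinates.

(** * The regular representation in coordinates *)

Section RegularRepresentation.
Set Implicit Arguments.
Unset Strict Implicit.
Variables (K : fieldType) (A : algType K) (B : falgType K).
Variables (chi : twistingMap A B).
Local Notation T := (twisted_tensor chi).

Lemma mulr_tens1 (d : B) (a a' : A) :
  (d \ox a : T) * (1 \ox a' : T) = d \ox (a * a').
Proof.
rewrite [LHS]twisted_mulE (twisting1r (twisting_mapP chi)).
by rewrite tensor_mapE /= /alg_mul mulr1.
Qed.

Lemma mul1_tens (a : A) (d : B) :
  (1 \ox a : T) * (d \ox 1 : T) = chi (a \ox d).
Proof. by rewrite [LHS]twisted_mulE tw1. Qed.

Lemma mull_tens1 (d d' : B) (a : A) :
  (d \ox 1 : T) * (d' \ox a : T) = (d * d') \ox a.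
Proof.
rewrite [LHS]twisted_mulE (twisting1l (twisting_mapP chi)).
by rewrite tensor_mapE /= /alg_mul mul1r.
Qed.

Variables (n : nat) (b : n.-tuple B).

Definition regular_mx (x : T) : 'M[A]_n :=
  \matrix_(i, j) tcoord b i (x * (b`_j \ox 1 : T)).

Lemma tcoord_mulr i (x : T) (a : A) :
  tcoord b i (x * (1 \ox a : T)) = tcoord b i x * a.
Proof.
elim/tensor_ind: x => [d a'|x y IHx IHy].
  by rewrite mulr_tens1 !tcoordE scalerAl.
by rewrite [_ * _]twisted_mulDl !raddfD /= [X in X + _]IHx [X in _ + X]IHy mulrDl.
Qed.

Fact regular_mx_linear : linear_for (in_alg A \; *:%R) regular_mx.
Proof.
move=> c x y; apply/matrixP => i j; rewrite !mxE.
by rewrite mulrDl -scalerAl raddfD /= linearZ /= mulr_algl.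
Qed.

HB.instance Definition _ := GRing.isLinear.Build K T 'M[A]_n
  (in_alg A \; *:%R) regular_mx regular_mx_linear.

Hypothesis hb : basis_of fullv b.

(** Left multiplication by x is right A-linear, hence it is given on coordinate
    columns by its matrix. *)
Lemma tcoord_mul i (x y : T) :
  tcoord b i (x * y) = \sum_(k < n) regular_mx x i k * tcoord b k y.
Proof.
rewrite {1}[y](tens_sum_tcoord hb) mulr_sumr raddf_sum /=.
apply: eq_bigr => k _; rewrite mxE -tcoord_mulr -mulrA.
by rewrite mulr_tens1 mul1r.
Qed.

Fact regular_mx_monoid_morphism : monoid_morphism regular_mx.
Proof.
split=> [|x y]; apply/matrixP => i j; rewrite !mxE.
  rewrite mul1r tcoord_basis // eq_sym.
  by case: eqP => _; rewrite ?scale1r ?scale0r.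
by rewrite -mulrA tcoord_mul; apply: eq_bigr => k _; rewrite [regular_mx y k j]mxE.
Qed.

(** By [tcoord_mul] the matrix of x determines x * y for every y, in particular
    x = x * 1. *)
Lemma regular_mx_inj : injective regular_mx.
Proof.
move=> x y exy; rewrite -[x]mulr1 -[y]mulr1.
rewrite [LHS](tens_sum_tcoord hb) [RHS](tens_sum_tcoord hb).
apply: eq_bigr => i _.
by rewrite !tcoord_mul exy.
Qed.

End RegularRepresentation.

Theorem corollary2p9 (K : fieldType) (A : algType K) (B : falgType K)
    (n : nat) (b : n.-tuple B) (hb : basis_of fullv b)
    (lambda : 'I_n -> 'I_n -> 'I_n -> K)
    (hlambda : forall i j : 'I_n,
      b`_i * b`_j = \sum_(k < n) lambda i j k *: b`_k)
    (chi : twistingMap A B)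
    (gamma : 'I_n -> 'I_n -> {linear A -> A})
    (hgamma : forall (a : A) (i : 'I_n),
      chi (a \ox b`_i) = \sum_(j < n) b`_j \ox gamma i j a) :
  exists phi : {lrmorphism twisted_tensor chi -> 'M[A]_n | in_alg A \; *:%R},
    [/\ forall a : A, phi (1 \ox a) = \matrix_(i, j) gamma j i a,
        forall k : 'I_n, phi (b`_k \ox 1) = \matrix_(i, j) (lambda k j i)%:A,
        injective phi
      & forall psi : {lrmorphism twisted_tensor chi -> 'M[A]_n
                       | in_alg A \; *:%R},
          (forall a : A, psi (1 \ox a) = \matrix_(i, j) gamma j i a) ->
          (forall k : 'I_n,
             psi (b`_k \ox 1) = \matrix_(i, j) (lambda k j i)%:A) ->
          psi =1 phi].
Proof.
have mono := regular_mx_monoid_morphism chi hb.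
pose phi : {lrmorphism twisted_tensor chi -> 'M[A]_n | in_alg A \; *:%R} :=
  HB.pack (@regular_mx K A B chi n b)
    (GRing.isMonoidMorphism.Build _ _ (@regular_mx K A B chi n b) mono).
have phiA a : phi (1 \ox a) = \matrix_(i, j) gamma j i a.
  by apply/matrixP => i j; rewrite !mxE mul1_tens hgamma tcoord_sum.
have phiB (k : 'I_n) : phi (b`_k \ox 1) = \matrix_(i, j) (lambda k j i)%:A.
  apply/matrixP => i j; rewrite !mxE mull_tens1 tcoordE hlambda.
  by rewrite coord_sum_free // (basis_free hb).
exists phi; split=> // [|psi psiA psiB x]; first exact: regular_mx_inj.
clearbody phi.
rewrite [x](tens_sum_tcoord hb) !raddf_sum /=; apply: eq_bigr => k _.
(* b_k (x) a = (b_k (x) 1) * (1 (x) a) splits each term into generators. *)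
rewrite -[tcoord _ k x]mul1r -mulr_tens1.
by rewrite !rmorphM /= psiA psiB phiA phiB.
Qed.
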